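(* Let $\mathfrak{X}$ be an infinite-dimensional complex separable Hilbert space and $T:\mathcal{D}(T)\subseteq\mathfrak{X}\to\mathfrak{X}$ a densely defined symmetric operator with $T^{-1}\in B(\mathfrak{X})$ compact. Let $\{z_n\}_{n\ge1}$ be the distinct eigenvalues of $T$ and $Q$ a scalar entire function whose zeros are exactly the $z_n$, all simple. Let $F$ be the $B(\mathfrak{X})$-valued entire function with $F(z)=Q(z)(zI-T)^{-1}$ for $z\notin\{z_n\}$, and let $\mathcal{H}=\mathcal{H}_F$. Then every $f\in\mathcal{H}$ is completely determined by $\{f(z_n)\}_{n\ge1}$ and $$f(z)=\sum_{n=1}^\infty\frac{Q(z)}{(z-z_n)Q'(z_n)}f(z_n)\quad\text{for all }z\in\mathbb{C}.$$
   Context: $\mathcal{H}_F=\{F(\cdot)u:u\in\mathfrak{X}\}$ with norm $\|f\|=\inf\{\|w\|_{\mathfrak{X}}:F(\cdot)w=f\}$; it is a reproducing kernel Hilbert space of $\mathfrak{X}$-valued entire functions with kernel $K_\gamma(z)=F(z)F(\gamma)^*$. *)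

(* Defs.v *)
(* Complex numbers: R[i] (mathcomp-real-closed),
   for R : realType; R[i]^o is R[i] viewed as a normed module over itself. *)
From mathcomp Require Import all_boot all_order all_algebra.
From mathcomp Require Import complex.
From mathcomp Require Import all_classical all_reals all_analysis.
Set Implicit Arguments. Unset Strict Implicit. Unset Printing Implicit Defensive.
Import Order.TTheory GRing.Theory Num.Theory.
Import numFieldNormedType.Exports.
Local Open Scope classical_set_scope.
Local Open Scope ring_scope.

Section Defs.
Variable R : realType.
Variable X : completeNormedModType R[i].

(* ip is a (complex) inner product inducing the norm of X;
   together with completeness of X this makes X a complex Hilbert space. *)
Definition inner_product (ip : X -> X -> R[i]) : Prop :=
  [/\ (forall (a : R[i]) (x y z : X), ip (a *: x + y) z = a * ip x z + ip y z),
      (forall x y : X, ip y x = (ip x y)^*) &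
      (forall x : X, ip x x = `|x| ^+ 2)].

Definition separable_space : Prop :=
  exists e : nat -> X, closure (range e) = setT.

Definition infinite_dimensional : Prop :=
  forall n : nat, exists v : 'I_n -> X,
    forall c : 'I_n -> R[i], \sum_(i < n) c i *: v i = 0 -> forall i, c i = 0.

(* an (unbounded) operator T with domain D : values of T outside D are irrelevant *)
Definition linear_subspace (D : set X) : Prop :=
  D 0 /\ forall (a : R[i]) (x y : X), D x -> D y -> D (a *: x + y).

Definition linear_on (D : set X) (T : X -> X) : Prop :=
  forall (a : R[i]) (x y : X), D x -> D y -> T (a *: x + y) = a *: T x + T y.

Definition densely_defined (D : set X) : Prop := closure D = setT.

Definition symmetric_operator (ip : X -> X -> R[i]) (D : set X) (T : X -> X) : Prop :=
  forall x y : X, D x -> D y -> ip (T x) y = ip x (T y).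

(* element of B(X) *)
Definition bounded_operator (S : X -> X) : Prop :=
  (forall (a : R[i]) (x y : X), S (a *: x + y) = a *: S x + S y) /\ continuous S.

Definition compact_operator (S : X -> X) : Prop :=
  compact (closure (S @` [set x : X | `|x| <= 1])).

(* T^{-1} exists, belongs to B(X) and is compact *)
Definition has_compact_bounded_inverse (D : set X) (T : X -> X) : Prop :=
  exists S : X -> X, [/\ bounded_operator S, compact_operator S,
    (forall x, D (S x) /\ T (S x) = x) & (forall x, D x -> S (T x) = x)].

Definition is_eigenvalue (D : set X) (T : X -> X) (z : R[i]) : Prop :=
  exists x : X, [/\ D x, x != 0 & T x = z *: x].

(* entire function of a complex variable (complex differentiable everywhere) *)
Definition entire (V : normedModType R[i]) (f : R[i] -> V) : Prop :=
  forall z : R[i], derivable (f : R[i]^o -> V) z 1.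

(* the space H_F = { F(.)u : u in X } *)
Definition H_F (F : R[i] -> X -> X) : set (R[i] -> X) :=
  [set f | exists u : X, f = fun z => F z u].

(* Q(z)/((z - z_n) Q'(z_n)), with its removable-singularity value 1 at z = z_n *)
Definition sampling_kernel (Q : R[i] -> R[i]^o) (zs : nat -> R[i]) (n : nat)
  (z : R[i]) : R[i] :=
  if z == zs n then 1 else Q z / ((z - zs n) * derive1 Q (zs n)).

End Defs.

(* Main.v *)
(* Let S = T^-1, a compact symmetric operator, and E_n the eigenspace of T for
   z_n, i.e. the set of e with e = z_n S e.
   Applying S to the resolvent equation removes the unbounded operator:
   z S F(z)u - F(z)u = Q(z) S u whenever Q(z) <> 0.  Letting z tend to the
   simple zero z_n shows F(z_n)u \in E_n, and pairing with e \in E_n before taking the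
   limit shows that F(z_n)u / Q'(z_n) is the orthogonal projection of u on E_n.
   Hence, for z off the spectrum, the n-th term of the series is the projection
   of w = F(z)u on E_n, and the expansion is the spectral expansion of w, which
   lies in the range of S.  At z = z_m the series has a single nonzero term. *)
Require Import Defs.
From mathcomp Require Import all_boot all_order all_algebra.
From mathcomp Require Import complex.
From mathcomp Require Import all_classical all_reals all_analysis.
From mathcomp Require Import ring.
Import Order.TTheory GRing.Theory Num.Theory.
Import numFieldNormedType.Exports.
Local Open Scope classical_set_scope.
Local Open Scope ring_scope.

(** * Cluster points and convergence in compact sets *)

Lemma cluster_closed (T : topologicalType) (F : set_system T) (B : set T) :
  closed B -> F B -> cluster F `<=` B.
Proof. by move=> cB FB x; rewrite clusterE => /(_ _ FB); exact: cB. Qed.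

(** If an open neighbourhood of [p] were not in [F], the trace of [F] on its complement would be
    proper and cluster in [A], giving [F] a cluster point other than [p]. *)
Lemma compact_cvg_cluster (T : topologicalType) (F : set_system T) (A : set T)
    (p : T) :
  ProperFilter F -> compact A -> F A -> cluster F `<=` [set p] -> F --> p.
Proof.
move=> FF cA FA clp U; rewrite nbhsE => -[V [oV Vp] VU].
apply: contrapT => nFU.
have GF : ProperFilter (within (~` V) F).
  apply: Build_ProperFilter_ex => B FB; apply: contrapT => B0; apply: nFU.
  move: FB; rewrite /within /=; apply: filterS => x Bx.
  apply: VU; apply: contrapT => nVx.
  by apply: B0; exists x; apply: Bx.
have [q [_ clq]] : (A `&` cluster (within (~` V) F)) !=set0.
  by apply: cA; apply: (cvg_within (F := F)).
have nVq : (~` V) q.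
  by apply: cluster_closed clq; [exact: open_closedC|exact: filter.withinT].
apply: nVq; suff -> : q = p by [].
by apply: clp => B C FB qC; apply: clq => //; exact: (cvg_within (F := F)).
Qed.

Lemma closed_eqfun (T U : topologicalType) (f : T -> U) (a : U) :
  hausdorff_space U -> continuous f -> closed [set x | f x = a].
Proof.
move=> hU cf; apply: (@preimage_closed _ _ f [set a]) => [x _|]; first exact: cf.
exact/accessible_closed_set1/hausdorff_accessible.
Qed.

(** * Algebra and continuity of the inner product *)

Section InnerProduct.
Context {R : realType} {X : completeNormedModType R[i]} (ip : X -> X -> R[i]).
Hypothesis ipP : inner_product ip.
Implicit Types (x y z : X) (a : R[i]).

Lemma ip_conj x y : ip y x = (ip x y)^*.
Proof. by case: ipP. Qed.

Lemma ipxx x : ip x x = `|x| ^+ 2.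
Proof. by case: ipP. Qed.

Lemma ipDl x y z : ip (x + y) z = ip x z + ip y z.
Proof. by case: ipP => /(_ 1 x y z); rewrite scale1r mul1r. Qed.

Lemma ip0l z : ip 0 z = 0.
Proof. by apply: (addrI (ip 0 z)); rewrite -ipDl !addr0. Qed.

Lemma ipZl a x z : ip (a *: x) z = a * ip x z.
Proof. by case: ipP => /(_ a x 0 z); rewrite ip0l !addr0. Qed.

Lemma ipNl x z : ip (- x) z = - ip x z.
Proof. by rewrite -scaleN1r ipZl mulN1r. Qed.

Lemma ipBl x y z : ip (x - y) z = ip x z - ip y z.
Proof. by rewrite ipDl ipNl. Qed.

Lemma ipDr x y z : ip x (y + z) = ip x y + ip x z.
Proof. by rewrite ip_conj ipDl rmorphD /= -!ip_conj. Qed.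

Lemma ipZr a x y : ip x (a *: y) = a^* * ip x y.
Proof. by rewrite ip_conj ipZl rmorphM /= -!ip_conj. Qed.

Lemma ipNr x y : ip x (- y) = - ip x y.
Proof. by rewrite ip_conj ipNl rmorphN /= -!ip_conj. Qed.

Lemma ipBr x y z : ip x (y - z) = ip x y - ip x z.
Proof. by rewrite ipDr ipNr. Qed.

Lemma ip_eq0C x y : ip x y = 0 -> ip y x = 0.
Proof. by rewrite ip_conj => /eqP; rewrite conjC_eq0 => /eqP. Qed.

Lemma ipxx_eq0 x : ip x x = 0 -> x = 0.
Proof. by rewrite ipxx => /eqP; rewrite sqrf_eq0 normr_eq0 => /eqP. Qed.

Lemma ip_suml (I : Type) (r : seq I) (P : pred I) (f : I -> X) z :
  ip (\sum_(i <- r | P i) f i) z = \sum_(i <- r | P i) ip (f i) z.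
Proof. by elim/big_rec2 : _ => [|i u v _ <-]; rewrite ?ip0l ?ipDl. Qed.

Lemma pythagoras x y : ip x y = 0 -> `|x + y| ^+ 2 = `|x| ^+ 2 + `|y| ^+ 2.
Proof.
move=> xy0; rewrite -!ipxx ipDl !ipDr xy0 (ip_eq0C _ _ xy0).
by rewrite addr0 add0r.
Qed.

(** Writing [ip] through norms lets it inherit their continuity. The two summands in the bracket are
    [ip x y + ip y x] and [ip x y - ip y x]. *)
Lemma ip_polarization x y : ip x y =
  2^-1 * ((`|x + y| ^+ 2 - `|x| ^+ 2 - `|y| ^+ 2)
    + 'i * (`|x + 'i *: y| ^+ 2 - `|x| ^+ 2 - `|'i *: y| ^+ 2)).
Proof.
rewrite -!ipxx !(ipDl, ipDr, ipZl, ipZr) conjCi.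
set a := ip x y; set b := ip y x; set c := ip x x; set d := ip y y.
have i2 : 'i * 'i = -1 :> R[i] by rewrite -expr2 sqrCi.
have -> : c + a + (b + d) - c - d = a + b by ring.
have -> : c + - 'i * a + ('i * b + 'i * (- 'i * d)) - c - 'i * (- 'i * d)
   = 'i * (b - a) by ring.
by rewrite mulrA i2; field.
Qed.

Lemma ip_continuous y : continuous (fun x => ip x y : R[i]^o).
Proof.
rewrite (_ : (fun x => _) = fun x =>
    (2^-1 * ((`|x + y| ^+ 2 - `|x| ^+ 2 - `|y| ^+ 2)
    + 'i * (`|x + 'i *: y| ^+ 2 - `|x| ^+ 2 - `|'i *: y| ^+ 2)) : R[i]^o)); last first.
  by apply/funext => x; exact: ip_polarization.
have sqD z : continuous (fun x : X => `|x + z| ^+ 2 : R[i]^o).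
  move=> x; rewrite /continuous_at; under eq_fun do rewrite expr2.
  by apply: cvgM; apply: cvg_norm; (apply: cvgD; [exact: cvg_id|exact: cvg_cst]).
have sq : continuous (fun x : X => `|x| ^+ 2 : R[i]^o).
  by under eq_fun do rewrite -[X in `|X|]addr0; exact: sqD.
have cB z : continuous (fun x : X => (`|x + z| ^+ 2 - `|x| ^+ 2 - `|z| ^+ 2 : R[i]^o)).
  by move=> x; apply: cvgB; [apply: cvgB; [exact: sqD|exact: sq]|exact: cvg_cst].
move=> x; apply: cvgM; first exact: cvg_cst.
by apply: cvgD; [exact: cB|apply: cvgM; [exact: cvg_cst|exact: cB]].
Qed.

End InnerProduct.

(** * Limits at a simple zero of a scalar function *)

Section LimitAtSimpleZero.
Context {K : numFieldType} {V : normedModType K}.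
Implicit Types (Q : K^o -> K^o) (G : K^o -> V) (a : K).

Let dnbhs_shift (W : normedModType K) (f : K^o -> W) a :
  derivable f a 1 -> f (h + a) @[h --> (0 : K)^'] --> f a.
Proof.
move=> df; have cf : {for a, continuous f}.
  by apply/differentiable_continuous/derivable1_diffP.
apply: cvg_within_filter.
have sh : (h + a) @[h --> (0 : K)] --> (a : K).
  rewrite -[a in X in _ --> X]add0r.
  by apply: (@cvgD _ _ _ (nbhs (0 : K))); [exact: cvg_id|exact: cvg_cst].
exact: cvg_comp sh cf.
Qed.

Let quotient_cvg Q a : derivable Q a 1 -> Q a = 0 ->
  h^-1 * Q (h + a) @[h --> (0 : K)^'] --> (derive1 Q a : K^o).
Proof.
move=> dQ Qa; rewrite derive1E /derive.
have -> : (fun h : K^o => h^-1 * Q (h + a)) =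
    (fun h => h^-1 *: ((Q \o shift a) (h *: (1 : K^o)) - Q a)).
  by apply/funext => h /=; rewrite Qa subr0 -[h%:A]/(h * 1) mulr1.
exact: dQ.
Qed.

Let quotient_neq0 Q a : derivable Q a 1 -> Q a = 0 -> derive1 Q a != 0 ->
  \forall h \near (0 : K)^', h != 0 /\ Q (h + a) != 0.
Proof.
move=> dQ Qa dQa; have : \forall h \near (0 : K)^', h^-1 * Q (h + a) != 0.
  exact: cvgr_neq0 (quotient_cvg _ _ dQ Qa) dQa.
by apply: filterS => h; rewrite mulf_eq0 invr_eq0 negb_or => /andP.
Qed.

(** A simple zero is isolated, so the identity holds on a punctured neighbourhood of [a] and passes
    to the limit, where its right-hand side vanishes. *)
Lemma eq_at_simple_zero Q G a (S : V -> V) (w : V) :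
  derivable Q a 1 -> derivable G a 1 -> continuous S ->
  Q a = 0 -> derive1 Q a != 0 ->
  (forall z, Q z != 0 -> z *: S (G z) - G z = Q z *: w) ->
  a *: S (G a) = G a.
Proof.
move=> dQ dG cS Qa dQa res.
pose g (h : K^o) := (h + a) *: S (G (h + a)) - G (h + a) - Q (h + a) *: w.
have g0 : g @ (0 : K)^' --> (0 : V).
  apply: cvg_near_cst; apply: filterS (quotient_neq0 _ _ dQ Qa dQa) => h [_ Qh].
  by rewrite /g res// subrr.
have gl : g @ (0 : K)^' --> a *: S (G a) - G a - Q a *: w.
  apply: cvgB; last by apply: cvgZr_tmp; exact: dnbhs_shift.
  apply: cvgB; last exact: dnbhs_shift.
  apply: cvgZ; first by apply: (dnbhs_shift _ (fun z => z)); exact: derivable_id.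
  exact: cvg_comp (dnbhs_shift _ _ _ dG) (cS _).
have : a *: S (G a) - G a - Q a *: w = 0 by exact: cvg_unique gl g0.
by rewrite Qa scale0r subr0 => /eqP; rewrite subr_eq0 => /eqP.
Qed.

(** Divide the identity by [z - a]: as [z] tends to [a], [Q z / (z - a)] tends to the derivative. *)
Lemma quotient_at_simple_zero Q G a (phi : V -> K^o) (c : K) :
  derivable Q a 1 -> derivable G a 1 -> continuous phi ->
  Q a = 0 -> derive1 Q a != 0 ->
  (forall z, Q z != 0 -> (z - a) * phi (G z) = Q z * c) ->
  phi (G a) = derive1 Q a * c.
Proof.
move=> dQ dG cphi Qa dQa res.
have l1 : phi (G (h + a)) @[h --> (0 : K)^'] --> phi (G a).
  exact: cvg_comp (dnbhs_shift _ _ _ dG) (cphi _).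
have l2 : h^-1 * Q (h + a) * c @[h --> (0 : K)^'] --> (derive1 Q a * c : K^o).
  by apply: cvgM; [exact: quotient_cvg|exact: cvg_cst].
apply: cvg_unique l1 _ => //.
apply: cvg_trans l2; apply: near_eq_cvg.
apply: filterS (quotient_neq0 _ _ dQ Qa dQa) => h [h0 Qh].
by rewrite -mulrA -res// addrK mulKf.
Qed.

End LimitAtSimpleZero.

(** * Linearity of bounded operators *)

Section BoundedOperator.
Context {R : realType} {X : completeNormedModType R[i]} {S : X -> X}.
Hypothesis SB : bounded_operator S.

Lemma bounded_operatorD x y : S (x + y) = S x + S y.
Proof. by case: SB => /(_ 1 x y); rewrite !scale1r. Qed.

Lemma bounded_operator0 : S 0 = 0.
Proof. by apply: (addrI (S 0)); rewrite -bounded_operatorD !addr0. Qed.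

Lemma bounded_operatorZ a x : S (a *: x) = a *: S x.
Proof. by case: SB => /(_ a x 0); rewrite bounded_operator0 !addr0. Qed.

End BoundedOperator.

(** * Norm bounds on compact and closed sets *)

Section RealNorm.
Context {R : realType} {X : normedModType R[i]}.

(** Norms take values in [R[i]], whose order is partial; the extreme value theorem and closed
    half-lines are used in [R]. *)
Let realnorm (x : X) : R := complex.Re `|x|.

Let realnormE x : `|x| = (realnorm x)%:C%C.
Proof. by rewrite RRe_real ?normr_real. Qed.

Let realnorm_continuous : continuous realnorm.
Proof.
move=> x; apply/(@cvgrPdist_lt R R^o) => e e0.
have /(@cvgrPdist_lt _ R[i]^o)/(_ e%:C%C) : `|y| @[y --> x] --> (`|x| : R[i]^o).
  by apply: cvg_norm; exact: cvg_id.
rewrite ltcR => /(_ e0); apply: filterS => y.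
by rewrite !realnormE -rmorphB /= normc_def /= expr0n /= addr0 sqrtr_sqr ltcR.
Qed.

Lemma compact_max_norm (A : set X) : A !=set0 -> compact A ->
  exists2 c, A c & forall t, A t -> `|t| <= `|c|.
Proof.
move=> A0 cA.
have [c cA' cmax] : exists2 c, c \in A & forall t, t \in A -> realnorm t <= realnorm c.
  by apply: compact_EVT_max => //; exact: continuous_subspaceT.
exists c => [|t At]; first exact: set_mem cA'.
by rewrite !realnormE lecR cmax ?inE.
Qed.

Lemma closed_le_norm (f g : X -> X) (a b : R[i]) : 0 <= a -> 0 <= b ->
  continuous f -> continuous g ->
  closed [set x | `|f x| ^+ 2 + a * `|g x| ^+ 2 <= b].
Proof.
move=> a0 b0 cf cg.
rewrite (_ : [set _ | _] =
  (fun x => realnorm (f x) ^+ 2 + complex.Re a * realnorm (g x) ^+ 2)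
    @^-1` [set r | r <= complex.Re b]); last first.
  apply/seteqP; split=> x /=.
    rewrite !realnormE -[a]RRe_real ?ger0_real// -[b]RRe_real ?ger0_real//.
    by rewrite -!rmorphXn -rmorphM -rmorphD lecR.
  rewrite !realnormE -[a in X in _ -> X]RRe_real ?ger0_real//.
  rewrite -[b in X in _ -> X]RRe_real ?ger0_real//.
  by rewrite -!rmorphXn -rmorphM -rmorphD lecR.
apply: preimage_closed; last exact: closed_le.
have sq (h : X -> X) : continuous h -> continuous (fun x => realnorm (h x) ^+ 2 : R^o).
  move=> ch x; rewrite /continuous_at; under eq_fun do rewrite expr2.
  have rh : realnorm (h y) @[y --> x] --> (realnorm (h x) : R^o).
    by apply: continuous_comp; [exact: ch|exact: realnorm_continuous].
  exact: cvgM.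
move=> x _.
apply: cvgD; first exact: sq.
by apply: cvgM; [exact: cvg_cst|exact: sq].
Qed.

End RealNorm.

(** * Eigenvectors of compact symmetric operators *)

Lemma defect_le (K : numDomainType) (L a b c : K) :
  a <= L * b -> L * (L * c) <= L * (L * 1) ->
  a - L * b - (L * b - L * (L * c)) <= L * (L - b).
Proof.
rewrite -subr_ge0 => h1; rewrite -subr_ge0 => h2; rewrite -subr_ge0.
suff -> : L * (L - b) - (a - L * b - (L * b - L * (L * c))) =
  (L * b - a) + (L * (L * 1) - L * (L * c)) by exact: addr_ge0.
by ring.
Qed.

Lemma defect_factor (K : comNzRingType) (l b : K) :
  l ^+ 6 - l ^+ 4 * b = l ^+ 2 * (l ^+ 2 * (l ^+ 2 - b)).
Proof. by ring. Qed.

Section CompactSymmetric.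
Context {R : realType} {X : completeNormedModType R[i]} {ip : X -> X -> R[i]}.
Hypothesis ipP : inner_product ip.
Context {S : X -> X}.
Hypothesis (SB : bounded_operator S) (Scpt : compact_operator S).
Hypothesis Ssym : forall x y, ip (S x) y = ip x (S y).

Let SD := bounded_operatorD SB.
Let S0 := bounded_operator0 SB.
Let SZ := bounded_operatorZ SB.

Let S_cont : continuous S.
Proof. by case: SB. Qed.

(* With [l] the maximum of [|S x|] over the unit ball of [M], one has
   [|S^2 x - l^2 x|^2 <= l^2 (l^2 - |S x|^2)] there; compactness gives a point
   where the right-hand side vanishes, and then [S^2 = l^2] factors. *)
Lemma compact_symmetric_eigenvector (M : set X) :
  closed M -> linear_subspace M -> (forall x, M x -> M (S x)) ->
  (exists2 x, M x & S x != 0) ->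
  exists y mu, [/\ M y, y != 0, mu != 0 & S y = mu *: y].
Proof.
move=> Mcl [M0 MD] MS [x0 Mx0 Sx0].
have MZ a x : M x -> M (a *: x) by move=> Mx; rewrite -[_ *: _]addr0; exact: MD.
have MDD x y : M x -> M y -> M (x + y).
  by move=> Mx My; rewrite -[x]scale1r; exact: MD.
(* The image of the unit ball of [M] need not be closed, so the maximum is taken over its closure:
   [c] is a limit of points [S x], and its norm is that of [S] on [M]. *)
pose A := S @` [set x | M x /\ `|x| <= 1].
have [||c Kc cmax] := @compact_max_norm R X (closure A).
- by exists 0; apply: subset_closure; exists 0 => //; split; rewrite ?normr0.
- apply: subclosed_compact Scpt _; first exact: closed_closure.
  by apply: closureS; apply: image_subset => x [].
have Mc : M c.
  move: Kc; rewrite closureE; apply; split=> // _ [x [Mx _] <-]; exact: MS.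
pose l := `|c|; have l_ge0 : 0 <= l by exact: normr_ge0.
have Sle x : M x -> `|S x| <= l * `|x|.
  move=> Mx; have [->|xn0] := eqVneq x 0; first by rewrite S0 !normr0 mulr0.
  have nx0 : 0 < `|x| by rewrite normr_gt0.
  have := cmax (S (`|x|^-1 *: x)) => /(_ _)/wrap[].
    apply: subset_closure; exists (`|x|^-1 *: x) => //; split; first exact: MZ.
    by rewrite normrZ normfV normr_id mulVf// gt_eqF.
  by rewrite SZ normrZ normfV normr_id mulrC ler_pdivrMr.
have l_gt0 : 0 < l.
  rewrite lt_neqAle l_ge0 andbT; apply/eqP => l0.
  by have := Sle _ Mx0; rewrite -l0 mul0r normr_le0 (negbTE Sx0).
have lC : l^* = l by apply: conj_Creal; exact: ger0_real.
pose U x := S (S x) - l ^+ 2 *: x.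
have MU x : M x -> M (U x).
  by move=> Mx; rewrite /U -scaleNr; apply: MDD; [exact: MS (MS _ Mx)|exact: MZ].
have Ule x : M x -> `|x| <= 1 -> `|U x| ^+ 2 <= l ^+ 2 * (l ^+ 2 - `|S x| ^+ 2).
  move=> Mx x1; rewrite -(ipxx ip ipP) /U.
  rewrite !(ipBl ip ipP, ipBr ip ipP, ipZl ip ipP, ipZr ip ipP).
  (* Symmetry turns both cross terms of the expanded square into [|S x| ^+ 2], up to the factor
     [l ^+ 2]. *)
  rewrite (Ssym (S x) x) -(Ssym x (S x)) !(ipxx ip ipP) rmorphXn /= lC.
  have h1 : `|S (S x)| ^+ 2 <= l ^+ 2 * `|S x| ^+ 2.
    by rewrite -exprMn ler_pXn2r ?nnegrE ?mulr_ge0 ?normr_ge0 ?Sle//; exact: MS.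
  have h2 : l ^+ 2 * (l ^+ 2 * `|x| ^+ 2) <= l ^+ 2 * (l ^+ 2 * 1).
    by rewrite !ler_wpM2l ?exprn_ge0// -[1](expr1n _ 2) ler_pXn2r ?nnegrE.
  exact: defect_le.
(* As [U] commutes with [S], the bound at [x] yields one involving only the point [S x]; being a
   closed condition, it reaches [c]. There, since [|c| = l], it forces [U c = 0]. *)
have Uc : `|U c| ^+ 2 + l ^+ 4 * `|c| ^+ 2 <= l ^+ 6.
  suff sub : closure A `<=` [set x | `|U x| ^+ 2 + l ^+ 4 * `|x| ^+ 2 <= l ^+ 6].
    exact: sub Kc.
  rewrite closureE; apply: smallest_sub.
    apply: closed_le_norm; rewrite ?exprn_ge0// => x; last exact: cvg_id.
    have SSx := continuous_comp (S_cont x) (S_cont (S x)).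
    apply: cvgB; last by apply: cvgZl_tmp; exact: cvg_id.
    exact: SSx.
  move=> _ [x [Mx x1] <-] /=.
  have -> : U (S x) = S (U x) by rewrite /U SD -!scaleNr SZ.
  have h1 : `|S (U x)| ^+ 2 <= l ^+ 2 * `|U x| ^+ 2.
    by rewrite -exprMn ler_pXn2r ?nnegrE ?mulr_ge0 ?normr_ge0 ?Sle//; exact: MU.
  have h2 : l ^+ 2 * `|U x| ^+ 2 <= l ^+ 2 * (l ^+ 2 * (l ^+ 2 - `|S x| ^+ 2)).
    by rewrite ler_wpM2l ?exprn_ge0//; exact: Ule.
  by rewrite -lerBrDr defect_factor; exact: le_trans h1 h2.
have {}Uc : U c = 0.
  apply/eqP; rewrite -normr_eq0 -sqrf_eq0 eq_le exprn_ge0// andbT.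
  rewrite -(lerD2r (l ^+ 4 * `|c| ^+ 2)) add0r; apply: le_trans Uc _.
  by rewrite -/l -exprD.
have c0 : c != 0 by rewrite -normr_gt0.
(* [U c = 0] factors as [(S - l) (S + l) c = 0]: either [c] has eigenvalue [- l], or [S c + l *: c]
   has eigenvalue [l]. *)
have [Sc|v0] := eqVneq (S c + l *: c) 0.
  exists c, (- l); split=> //; first by rewrite oppr_eq0 gt_eqF.
  by apply/eqP; rewrite scaleNr -addr_eq0 Sc.
exists (S c + l *: c), l; split=> //; last 2 first.
- by rewrite gt_eqF.
- rewrite SD SZ scalerDr scalerA -expr2 addrC; congr (_ + _).
  by apply/eqP; rewrite -subr_eq0; apply/eqP.
by apply: MDD; [exact: MS|exact: MZ].
Qed.

End CompactSymmetric.

(** * Eigenspaces and the spectral expansion *)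

Section EigenExpansion.
Context {R : realType} {X : completeNormedModType R[i]} {ip : X -> X -> R[i]}.
Hypothesis ipP : inner_product ip.
Context {S : X -> X}.
Hypothesis SB : bounded_operator S.
Hypothesis Ssym : forall x y, ip (S x) y = ip x (S y).

Let SD := bounded_operatorD SB.
Let S0 := bounded_operator0 SB.
Let SZ := bounded_operatorZ SB.

(* The eigenspace of [S^-1] for [z], written without [S^-1]. *)
Definition inv_eigenspace (z : R[i]) : set X := [set e | e = z *: S e].

Lemma inv_eigenspaceS z e : inv_eigenspace z e -> inv_eigenspace z (S e).
Proof. by move=> ez; rewrite /inv_eigenspace /= -SZ -ez. Qed.

Lemma inv_eigenspaceZ z a e : inv_eigenspace z e -> inv_eigenspace z (a *: e).
Proof. by move=> ez; rewrite /inv_eigenspace /= SZ scalerA mulrC -scalerA -ez. Qed.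

Lemma inv_eigenspaceB z e e' :
  inv_eigenspace z e -> inv_eigenspace z e' -> inv_eigenspace z (e - e').
Proof.
move=> ez ez'; rewrite -scaleN1r /inv_eigenspace /= SD scalerDr -ez.
by congr (_ + _); exact: inv_eigenspaceZ.
Qed.

Lemma ip_inv_eigenspace z x e : z^* = z -> inv_eigenspace z e ->
  ip x e = z * ip (S x) e.
Proof. by move=> zr ez; rewrite {1}ez (ipZr ip ipP) zr Ssym. Qed.

(** Since [z'] is real, moving [S] across shows that [ip e e'] is both [z] and [z'] times
    [ip (S e) e']. *)
Lemma inv_eigenspace_orth z z' e e' : z != z' -> z'^* = z' ->
  inv_eigenspace z e -> inv_eigenspace z' e' -> ip e e' = 0.
Proof.
move=> zz' zr' ez ez'.
have h1 : ip e e' = z' * ip (S e) e' by exact: ip_inv_eigenspace.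
have h2 : ip e e' = z * ip (S e) e' by rewrite {1}ez (ipZl ip ipP).
have : (z - z') * ip (S e) e' = 0 by rewrite mulrBl -h1 -h2 subrr.
move/eqP; rewrite mulf_eq0 subr_eq0 (negbTE zz') /= => /eqP Se0.
by rewrite h1 Se0 mulr0.
Qed.

(** A relation rather than a function, because the projections are later exhibited as residues of
    the resolvent. *)
Definition is_eigenproj (z : R[i]) (x p : X) :=
  inv_eigenspace z p /\ forall e, inv_eigenspace z e -> ip (x - p) e = 0.

Lemma is_eigenproj_unique z x p p' :
  is_eigenproj z x p -> is_eigenproj z x p' -> p = p'.
Proof.
move=> [pz px] [pz' px']; apply/eqP; rewrite -subr_eq0; apply/eqP/(ipxx_eq0 ip ipP).
have dz : inv_eigenspace z (p - p') by exact: inv_eigenspaceB.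
have {1}-> : p - p' = (x - p') - (x - p) by rewrite opprB [RHS]addrC addrA subrK.
by rewrite (ipBl ip ipP) px ?px' ?subrr.
Qed.

Lemma is_eigenprojS z x p : is_eigenproj z x p -> is_eigenproj z (S x) (S p).
Proof.
move=> [pz px]; split=> [|e ez]; first exact: inv_eigenspaceS.
rewrite -[- S p]scaleN1r -SZ -SD scaleN1r Ssym.
exact/px/inv_eigenspaceS.
Qed.

Hypothesis (Scpt : compact_operator S) (Sinj : forall x, S x = 0 -> x = 0).
Context (zs : nat -> R[i]).
Hypotheses (zs_inj : injective zs) (zs_real : forall n, (zs n)^* = zs n).
Hypothesis zsP : forall mu x, mu != 0 -> x != 0 -> S x = mu *: x ->
  exists n, mu^-1 = zs n.

(** The common orthogonal complement [M] is closed and [S]-invariant. Were [S] nonzero on it, [M]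
    would contain an eigenvector, which lies in some eigenspace and so is orthogonal to itself. *)
Lemma eigenspaces_complete x :
  (forall n e, inv_eigenspace (zs n) e -> ip x e = 0) -> x = 0.
Proof.
pose M := [set x | forall n e, inv_eigenspace (zs n) e -> ip x e = 0].
move=> Mx; apply: Sinj; apply: contrapT => /eqP Sx0.
have [|||| y [mu [My y0 mu0 Sy]]] :=
  compact_symmetric_eigenvector ipP SB Scpt Ssym M.
- rewrite (_ : M = \bigcap_n \bigcap_(e in inv_eigenspace (zs n)) [set x | ip x e = 0]).
    apply: closed_bigI => n _; apply: closed_bigI => e _.
    apply: (@closed_eqfun X R[i]^o); first exact: norm_hausdorff.
    exact: ip_continuous.
  apply/seteqP; split=> [y My n _ e ez|y My n e ez]; [exact: My _ _ ez|].
  exact: My _ I _ ez.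
- split=> [n e _|a y y' My My' n e ez]; first exact: ip0l.
  by rewrite (ipDl ip ipP) (ipZl ip ipP) (My _ _ ez) (My' _ _ ez) mulr0 addr0.
- by move=> y My n e ez; rewrite Ssym; apply: (My n); exact: inv_eigenspaceS.
- by exists x.
have [n mun] := zsP _ _ mu0 y0 Sy.
have yn : inv_eigenspace (zs n) y.
  by rewrite /inv_eigenspace /= Sy scalerA -mun mulVf// scale1r.
by move: y0; rewrite (ipxx_eq0 ip ipP _ (My _ _ yn)) eqxx.
Qed.

(* The partial sums lie in a compact set, since those of [x] are bounded by
   Bessel's inequality, and completeness of the eigenspaces leaves [S x] as
   their only cluster point. *)
Lemma eigen_expansion x (p r : nat -> X) :
  (forall n, is_eigenproj (zs n) x (p n)) ->
  (forall n, is_eigenproj (zs n) (S x) (r n)) ->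
  (fun N => \sum_(0 <= n < N) r n) @ \oo --> S x.
Proof.
move=> pP rP; pose s N := \sum_(0 <= n < N) p n.
(* [S] carries the eigenprojections of [x] to those of [S x], and projections are unique. *)
have sE N : \sum_(0 <= n < N) r n = S (s N).
  rewrite /s (big_morph S SD S0); apply: eq_bigr => n _.
  exact: is_eigenproj_unique (rP n) (is_eigenprojS _ _ _ (pP n)).
under eq_fun do rewrite sE.
have ip_s N m e : (m < N)%N -> inv_eigenspace (zs m) e -> ip (s N) e = ip x e.
  move=> mN em; rewrite /s (ip_suml ip ipP) (bigD1_seq m) ?iota_uniq//=; last first.
    by rewrite mem_index_iota.
  rewrite big1 ?addr0 => [|n nm]; last first.
    apply: inv_eigenspace_orth (zs_real m) (pP n).1 em.
    by apply: contra_neq nm; exact: zs_inj.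
  by apply/esym/eqP; rewrite -subr_eq0 -(ipBl ip ipP) (pP m).2.
have bessel N : `|s N| <= `|x|.
  have orth : ip (s N) (x - s N) = 0.
    rewrite {1}/s (ip_suml ip ipP) big_nat big1// => n /andP[_ nN].
    apply: (ip_eq0C ip ipP); rewrite (ipBl ip ipP) (ip_s _ n) ?subrr//.
    exact: (pP n).1.
  rewrite -(ler_pXn2r (n := 2)) ?nnegrE// -[in leRHS](subrKC (s N) x).
  by rewrite (pythagoras ip ipP _ _ orth) lerDl exprn_ge0.
(* The [+ 1] keeps [c] positive when [x = 0], so that [s N] can be rescaled into the unit ball. *)
pose c := `|x| + 1; have c0 : 0 < c by rewrite ltr_wpDl.
apply: (@compact_cvg_cluster _ _ ( *:%R c @` closure (S @` [set x | `|x| <= 1]))).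
- apply: continuous_compact; last exact: Scpt.
  by apply: continuous_subspaceT => y; exact: scaler_continuous.
- exists 0 => // N _ /=; exists (S (c^-1 *: s N)).
    apply: subset_closure; exists (c^-1 *: s N) => //=.
    rewrite normrZ normfV gtr0_norm// mulrC ler_pdivrMr// mul1r.
    by rewrite (le_trans (bessel N))// lerDl.
  by rewrite SZ scalerA divff ?gt_eqF// scale1r.
move=> q clq; apply/eqP; rewrite -subr_eq0; apply/eqP.
apply: eigenspaces_complete => m e em.
suff -> : ip (q - S x) e = ip q e - ip (S x) e.
  apply/eqP; rewrite subr_eq0; apply/eqP.
  (* Once [N > m], the pairing of [S (s N)] with [e] is constant, and a closed condition passes to
     cluster points. *)
  apply: (@cluster_closed _ _ [set y | ip y e = ip (S x) e] _ _ q clq).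
    apply: (@closed_eqfun X R[i]^o); first exact: norm_hausdorff.
    exact: ip_continuous.
  exists m.+1 => // N /= mN.
  by rewrite !Ssym; apply: ip_s mN _; exact: inv_eigenspaceS.
exact: ipBl.
Qed.

End EigenExpansion.

(** * Residues of the resolvent *)

Section ResolventAtZero.
Context {R : realType} {X : completeNormedModType R[i]} {ip : X -> X -> R[i]}.
Hypothesis ipP : inner_product ip.
Context {S : X -> X}.
Hypothesis SB : bounded_operator S.
Hypothesis Ssym : forall x y, ip (S x) y = ip x (S y).

Lemma is_eigenproj_at_simple_zero (Q : R[i] -> R[i]^o) (G : R[i] -> X)
    (z0 : R[i]) (u : X) :
  entire Q -> entire G -> Q z0 = 0 -> derive1 Q z0 != 0 -> z0^* = z0 ->
  (forall z, Q z != 0 -> z *: S (G z) - G z = Q z *: S u) ->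
  is_eigenproj (ip := ip) (S := S) z0 u ((derive1 Q z0)^-1 *: G z0).
Proof.
move=> eQ eG Qz0 dQ0 z0r res.
have cS := SB.2.
have eigG : inv_eigenspace (S := S) z0 (G z0).
  exact/esym/(eq_at_simple_zero _ _ _ _ _ (eQ z0) (eG z0) cS Qz0 dQ0 res).
split; first exact: inv_eigenspaceZ.
move=> e ez.
(* Pairing is done through [S]: since [ip (G z) e = z0 * ip (S (G z)) e], the resolvent identity
   acquires the factor [z - z0]. *)
have cphi : continuous (fun x => ip (S x) e : R[i]^o).
  move=> x; apply: (@continuous_comp X X R[i]^o S (fun y => ip y e)).
    exact: cS.
  exact: ip_continuous.
have ipG : ip (S (G z0)) e = derive1 Q z0 * ip (S u) e.
  apply: (quotient_at_simple_zero Q G z0 (fun x => ip (S x) e) _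
    (eQ z0) (eG z0) cphi Qz0 dQ0) => z Qz.
  have := congr1 (fun v => ip v e) (res _ Qz).
  rewrite (ipBl ip ipP) !(ipZl ip ipP) => <-.
  by rewrite mulrBl -(ip_inv_eigenspace ipP Ssym _ _ _ z0r ez).
rewrite (ipBl ip ipP) (ipZl ip ipP).
rewrite (ip_inv_eigenspace ipP Ssym _ u _ z0r ez).
rewrite (ip_inv_eigenspace ipP Ssym _ (G z0) _ z0r ez) ipG.
by rewrite mulrCA mulKf// subrr.
Qed.

End ResolventAtZero.

(** * The sampling expansion and determination by samples *)

Theorem theorem4p2 (R : realType) (X : completeNormedModType R[i])
  (ip : X -> X -> R[i]) (D : set X) (T : X -> X)
  (zs : nat -> R[i]) (Q : R[i] -> R[i]^o) (F : R[i] -> X -> X) :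
  (* X is an infinite-dimensional complex separable Hilbert space *)
  inner_product ip -> separable_space X -> infinite_dimensional X ->
  (* T : D(T) -> X densely defined symmetric, T^{-1} in B(X) compact *)
  linear_subspace D -> linear_on D T -> densely_defined D ->
  symmetric_operator ip D T -> has_compact_bounded_inverse D T ->
  (* {z_n} : the distinct eigenvalues of T *)
  injective zs -> (forall z, is_eigenvalue D T z <-> exists n, z = zs n) ->
  (* Q entire, zeros exactly the z_n, all simple *)
  entire Q -> (forall z, Q z = 0 <-> exists n, z = zs n) ->
  (forall n, derive1 Q (zs n) != 0) ->
  (* F : B(X)-valued entire with F(z) = Q(z)(zI - T)^{-1} off {z_n} *)
  (forall z, bounded_operator (F z)) ->
  (forall u, entire (fun z => F z u)) ->
  (forall z, ~ is_eigenvalue D T z ->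
     forall u, D (F z u) /\ z *: F z u - T (F z u) = Q z *: u) ->
  (forall f g, H_F F f -> H_F F g -> (forall n, f (zs n) = g (zs n)) -> f = g)
  /\
  (forall f, H_F F f -> forall z : R[i],
     (fun N => \sum_(0 <= n < N) sampling_kernel Q zs n z *: f (zs n)) @ \oo
       --> f z).
Proof.
move=> ipP _ _ _ linT _ symT [S [SB Scpt ST TS]] zs_inj eigP eQ Q0 dQ0 _ eF resF.
have S0 := bounded_operator0 SB; have SD := bounded_operatorD SB.
have SZ := bounded_operatorZ SB.
have Ssym x y : ip (S x) y = ip x (S y).
  by rewrite -{1}(ST y).2 -(symT _ _ (ST x).1 (ST y).1) (ST x).2.
have Sinj x : S x = 0 -> x = 0.
  by move=> Sx0; rewrite -(ST x).2 Sx0 -S0 (ST 0).2.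
have zs_real n : (zs n)^* = zs n.
  have [x [Dx x0 Tx]] : is_eigenvalue D T (zs n) by apply/eigP; exists n.
  have := symT _ _ Dx Dx; rewrite Tx (ipZl ip ipP) (ipZr ip ipP) => /esym.
  by apply: mulIf; apply: contra_neq x0; exact: ipxx_eq0.
have zsP mu x : mu != 0 -> x != 0 -> S x = mu *: x -> exists n, mu^-1 = zs n.
  move=> mu0 x0 Sx; apply/eigP; exists x.
  have xE : S (mu^-1 *: x) = x by rewrite SZ Sx scalerA mulVf ?scale1r.
  by have := ST (mu^-1 *: x); rewrite xE => -[].
have Qzs n : Q (zs n) = 0 by apply/Q0; exists n.
have neig z : Q z != 0 -> ~ is_eigenvalue D T z.
  by move=> Qz /eigP zE; move: Qz; rewrite (Q0 z).2 ?eqxx.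
have res u z : Q z != 0 -> z *: S (F z u) - F z u = Q z *: S u.
  move=> Qz; have [DF Fres] := resF _ (neig _ Qz) u.
  by rewrite -(SZ (Q z)) -Fres [in RHS]addrC 
    -[- T _]scaleN1r SD !SZ scaleN1r (TS _ DF) addrC.
have proj u n : is_eigenproj (ip := ip) (S := S) (zs n) u
    ((derive1 Q (zs n))^-1 *: F (zs n) u).
  apply: (is_eigenproj_at_simple_zero ipP SB Ssym _ (fun z => F z u)) => //.
  exact: res.
have sampling u z :
    (fun N => \sum_(0 <= n < N) sampling_kernel Q zs n z *: F (zs n) u) @ \oo
      --> F z u.
  have [[m ->]|nz] := pselect (exists m, z = zs m).
    (* The kernel of index [m] takes its removable value [1] here and the others vanish with [Q], so
       partial sums are constant from [m.+1] on. *)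
    apply: cvg_near_cst; exists m.+1 => // N /= mN.
    rewrite (bigD1_seq m) ?iota_uniq ?mem_index_iota//= big1 => [|n nm].
      by rewrite /sampling_kernel eqxx scale1r addr0.
    rewrite /sampling_kernel ifN ?Qzs ?mul0r ?scale0r//.
    by apply: contra_neq nm => /zs_inj.
  have Qz : Q z != 0 by apply/eqP => /Q0.
  have [DF Fres] := resF _ (neig _ Qz) u.
  have zn n : z - zs n != 0.
    by rewrite subr_eq0; apply/eqP => zE; apply: nz; exists n.
  (* [F z u] is [S] applied to [T (F z u)], whose eigenprojections are supplied by [proj]. *)
  rewrite -(TS _ DF).
  apply: (eigen_expansion ipP SB Ssym Scpt Sinj zs zs_inj zs_real zsP _ _ _
    (proj (T (F z u)))) => n.
  rewrite (TS _ DF); have [eigp ortp] := proj u n.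
  have -> : sampling_kernel Q zs n z *: F (zs n) u =
      (Q z / (z - zs n)) *: ((derive1 Q (zs n))^-1 *: F (zs n) u).
    rewrite /sampling_kernel ifN; last by rewrite -subr_eq0.
    by rewrite scalerA invfM mulrA.
  split=> [|e ez]; first exact: inv_eigenspaceZ.
  (* Paired with [e], the resolvent identity becomes [(z - zs n) * ip (S (F z u)) e = Q z * ip (S u)
     e]; a factor [zs n] recovers the pairings of [F z u] and [u]. *)
  have := congr1 (fun v => ip v e) (res u _ Qz).
  rewrite !(ipBl ip ipP) !(ipZl ip ipP) => rese.
  move/eqP: (ortp e ez); rewrite (ipBl ip ipP) (ipZl ip ipP) subr_eq0 => /eqP <-.
  rewrite (ip_inv_eigenspace ipP Ssym _ u _ (zs_real n) ez).
  rewrite (ip_inv_eigenspace ipP Ssym _ (F z u) _ (zs_real n) ez) in rese *.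
  rewrite mulrCA [_ / _ * _]mulrAC -rese -mulrBl.
  by rewrite [(z - zs n) * _]mulrC mulfK ?subrr.
split=> [_ _ [u ->] [v ->] uv|_ [u ->] z]; last exact: sampling.
(* Equal samples give the same series, and limits are unique. *)
apply/funext => z.
have uvE : (fun N => \sum_(0 <= n < N) sampling_kernel Q zs n z *: F (zs n) u) =
    (fun N => \sum_(0 <= n < N) sampling_kernel Q zs n z *: F (zs n) v).
  by apply/funext => N; apply: eq_bigr => n _; have /= -> := uv n.
by have := sampling v z; rewrite -uvE; apply: cvg_unique (sampling u z).
Qed.
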